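(* Let $\alpha,\beta,\gamma,\delta\in\mathbb{R}$ with $\alpha+\delta\neq 0$ and $\alpha\gamma-\beta\delta=0$, and let $(G_6,g,J)$ be the connected, simply connected three-dimensional Lorentzian Lie group with product structure $J$ whose Lie algebra $\mathfrak{g}$ has a pseudo-orthonormal basis $\{e_1,e_2,e_3\}$ ($e_3$ timelike) with $[e_1,e_2]=\alpha e_2+\beta e_3$, $[e_1,e_3]=\gamma e_2+\delta e_3$, $[e_2,e_3]=0$. Let $c\in\mathbb{R}$. Then $(G_6,g,J)$ is a second kind algebraic Ricci soliton associated to the canonical connection $\nabla^0$ with constant $c$ if and only if one of the following holds: (i) $\beta=\gamma=0$, $\alpha^2+c=0$, $\alpha+\delta\neq 0$; in particular, $De_1=0$, $De_2=0$, $De_3=-ce_3$; (ii) $\gamma=\delta=c=0$, $\alpha\neq 0$, $\beta\neq 0$, $\beta^2=2\alpha^2$; in particular, $D=0$.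
   Context: The left-invariant Lorentzian metric $g$ satisfies $g(e_1,e_1)=g(e_2,e_2)=1$, $g(e_3,e_3)=-1$, $g(e_i,e_j)=0$ for $i\ne j$. All tensors and connections are left-invariant and evaluated on $\mathfrak{g}$. $\nabla$ is the Levi-Civita connection of $g$. The product structure is $Je_1=e_1$, $Je_2=e_2$, $Je_3=-e_3$, and $(\nabla_XJ)Y=\nabla_X(JY)-J(\nabla_XY)$. The canonical connection is $\nabla^0_XY=\nabla_XY-\frac12(\nabla_XJ)(JY)$, with curvature $R^0(X,Y)Z=\nabla^0_X\nabla^0_YZ-\nabla^0_Y\nabla^0_XZ-\nabla^0_{[X,Y]}Z$. Its Ricci tensor is $\rho^0(X,Y)=-g(R^0(X,e_1)Y,e_1)-g(R^0(X,e_2)Y,e_2)+g(R^0(X,e_3)Y,e_3)$; its symmetrization is $\widetilde\rho^0(X,Y)=\frac12(\rho^0(X,Y)+\rho^0(Y,X))$, and the operator $\widetilde{\mathrm{Ric}}^0$ is defined by $\widetilde\rho^0(X,Y)=g(\widetilde{\mathrm{Ric}}^0(X),Y)$. Second kind algebraic Ricci soliton associated to $\nabla^0$ with constant $c$ means: $\widetilde{\mathrm{Ric}}^0=c\,\mathrm{Id}+D$ where $D$ is a derivation of $\mathfrak{g}$, i.e. a linear map with $D[X,Y]=[DX,Y]+[X,DY]$ for all $X,Y\in\mathfrak{g}$. *)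

(* Defs.v *)
From HB Require Import structures.
From mathcomp Require Import all_boot all_order all_algebra sesquilinear.
From mathcomp Require Import reals.

Set Implicit Arguments.
Unset Strict Implicit.
Unset Printing Implicit Defensive.

Import GRing.Theory Num.Theory.
Local Open Scope ring_scope.

Section LorentzianLieAlgebra.
Variables (R : realType) (V : vectType R).

Definition is_lie_bracket (br : {bilinear V -> V -> V}) : Prop :=
  (forall X, br X X = 0) /\
  (forall X Y Z, br X (br Y Z) + br Y (br Z X) + br Z (br X Y) = 0).

Variables (br : {bilinear V -> V -> V}) (g : {biscalar V}).

Definition derivation (D : 'End(V)) : Prop :=
  forall X Y, D (br X Y) = br (D X) Y + br X (D Y).

(* For left-invariant X, Y, Z the function g(Y, Z) is constant on the group, so
   compatibility X g(Y, Z) = g(nabla_X Y, Z) + g(Y, nabla_X Z) has left-hand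
   side 0. *)
Definition levi_civita (nabla : {bilinear V -> V -> V}) : Prop :=
  (forall X Y, nabla X Y - nabla Y X = br X Y) /\
  (forall X Y Z, g (nabla X Y) Z + g Y (nabla X Z) = 0).

Definition pseudo_orthonormal (e1 e2 e3 : V) : Prop :=
  (forall X Y, g X Y = g Y X) /\
  [/\ g e1 e1 = 1, g e2 e2 = 1 & g e3 e3 = - 1] /\
  [/\ g e1 e2 = 0, g e1 e3 = 0 & g e2 e3 = 0].

Definition product_structure (e1 e2 e3 : V) (J : 'End(V)) : Prop :=
  [/\ J e1 = e1, J e2 = e2 & J e3 = - e3].

Section CanonicalConnection.
Variables (nabla : {bilinear V -> V -> V}) (J : 'End(V)) (e1 e2 e3 : V).

Definition nablaJ (X Y : V) : V := nabla X (J Y) - J (nabla X Y).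

Definition nabla0 (X Y : V) : V := nabla X Y - 2^-1 *: nablaJ X (J Y).

Definition curv0 (X Y Z : V) : V :=
  nabla0 X (nabla0 Y Z) - nabla0 Y (nabla0 X Z) - nabla0 (br X Y) Z.

Definition ric0 (X Y : V) : R :=
  - g (curv0 X e1 Y) e1 - g (curv0 X e2 Y) e2 + g (curv0 X e3 Y) e3.

Definition ric0_sym (X Y : V) : R := 2^-1 * (ric0 X Y + ric0 Y X).

(* Such an operator exists and is unique, because g is nondegenerate. *)
Definition is_Ric0_sym (Ric : 'End(V)) : Prop :=
  forall X Y, ric0_sym X Y = g (Ric X) Y.

Definition soliton_derivation (c : R) (D : 'End(V)) : Prop :=
  derivation D /\
  exists Ric : 'End(V), is_Ric0_sym Ric /\ Ric = c *: \1%VF + D.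

Definition second_kind_algebraic_ricci_soliton (c : R) : Prop :=
  exists D : 'End(V), soliton_derivation c D.

End CanonicalConnection.
End LorentzianLieAlgebra.

(* Main.v *)
(* The canonical connection is the average of nabla and J nabla J, so it keeps
   only the part of nabla preserving the splitting <e1, e2> + <e3>.  Metric
   compatibility reduces that part to w(X) times the rotation of <e1, e2>,
   where w(X) = g(nabla_X e1, e2).  These rotations commute, hence the
   curvature R0(X, Y) is - w([X, Y]) times the rotation and the symmetrized
   Ricci tensor depends only on p = w([e1, e2]) and s = w([e1, e3]) / 2.  For
   the given bracket s = - gamma (alpha + delta) / 4, and the derivation
   property of Ric - c Id becomes a polynomial system; two of its equations sum
   to (p - c) (alpha + delta) = 0, which forces c = p, and the others then force
   gamma = 0. *)
Require Import Defs.
From HB Require Import structures.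
From mathcomp Require Import all_boot all_order all_algebra sesquilinear.
From mathcomp Require Import reals ring lra.

Set Implicit Arguments.
Unset Strict Implicit.
Unset Printing Implicit Defensive.

Import GRing.Theory Num.Theory.
Local Open Scope ring_scope.

(** * Expansion in a pseudo-orthonormal frame *)

Section PseudoOrthonormalFrame.
Variables (R : realType) (V : vectType R) (g : {biscalar V}) (e1 e2 e3 : V).
Hypothesis h_basis : basis_of fullv [:: e1; e2; e3].
Hypothesis h_g : pseudo_orthonormal g e1 e2 e3.

Let gC X Y : g X Y = g Y X. Proof. exact: h_g.1. Qed.

Lemma frame_metric :
  (((g e1 e1 = 1) * (g e2 e2 = 1) * (g e3 e3 = - 1))
  * ((g e1 e2 = 0) * (g e1 e3 = 0) * (g e2 e3 = 0))
  * ((g e2 e1 = 0) * (g e3 e1 = 0) * (g e3 e2 = 0)))%type.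
Proof.
have [_ [[g11 g22 g33] [g12 g13 g23]]] := h_g.
by do !split => //; rewrite gC.
Qed.

Definition biscalarE :=
  (@linearDl _ _ _ _ _ _ g, @linearBl _ _ _ _ _ _ g, @linearNl _ _ _ _ _ _ g,
   @linear0l _ _ _ _ _ _ g, @linearZl_LR _ _ _ _ _ _ g,
   @linearDr _ _ _ _ _ _ g, @linearBr _ _ _ _ _ _ g, @linearNr _ _ _ _ _ _ g,
   @linear0r _ _ _ _ _ _ g, @linearZr_LR _ _ _ _ _ _ g).

(** Pairing a spanning combination with the frame gives the coefficients; the minus sign compensates
    for [g e3 e3 = - 1]. *)
Lemma frame_expand X : X = g X e1 *: e1 + g X e2 *: e2 - g X e3 *: e3.
Proof.
have : X \in <<[:: e1; e2; e3]>>%VS by rewrite (span_basis h_basis) memvf.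
rewrite !span_cons span_nil addv0 => /memv_addP[_ /vlineP[a ->]].
move=> [_ /memv_addP[_ /vlineP[b ->] [_ /vlineP[d ->] ->]] ->].
rewrite !biscalarE /= !frame_metric.
by rewrite !(mulr0, mulr1, mulrN1, addr0, add0r) scaleNr opprK addrA.
Qed.

(** Nondegeneracy of [g]: below, it turns vector identities into three scalar ones for [ring] or
    [field]. *)
Lemma frame_ext X Y :
  g X e1 = g Y e1 -> g X e2 = g Y e2 -> g X e3 = g Y e3 -> X = Y.
Proof.
by move=> E1 E2 E3; rewrite (frame_expand X) (frame_expand Y) E1 E2 E3.
Qed.

Section ProductStructure.
Variable J : 'End(V).
Hypothesis h_J : product_structure e1 e2 e3 J.

Lemma product_structureE X :
  J X = g X e1 *: e1 + g X e2 *: e2 + g X e3 *: e3.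
Proof.
have [J1 J2 J3] := h_J.
rewrite {1}(frame_expand X) linearB linearD !linearZ /= J1 J2 J3.
by rewrite opprK.
Qed.

Lemma product_structure_metric X :
  ((g (J X) e1 = g X e1) * (g (J X) e2 = g X e2) * (g (J X) e3 = - g X e3)
  )%type.
Proof.
rewrite product_structureE !biscalarE /= !frame_metric.
by rewrite !(mulr0, mulr1, mulrN1, addr0, add0r).
Qed.

(** * Canonical connection, its curvature and Ricci tensor *)

Section LeviCivita.
Variables (br nabla : {bilinear V -> V -> V}).
Hypothesis h_nabla : levi_civita br g nabla.

(** Koszul formula without derivative terms: torsion-freeness replaces brackets by differences of
    [nabla], and three cyclic instances of compatibility combine linearly. *)
Lemma koszul X Y Z :
  2 * g (nabla X Y) Z = g (br X Y) Z - g (br Y Z) X + g (br Z X) Y.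
Proof.
have [tor com] := h_nabla; rewrite -!tor !biscalarE.
have := com X Y Z; have := com Y Z X; have := com Z X Y.
rewrite ![g _ (nabla _ _)]gC; lra.
Qed.

Local Notation w X := (g (nabla X e1) e2).

Lemma nabla0E X Z :
  nabla0 nabla J X Z = w X *: (g Z e1 *: e2 - g Z e2 *: e1).
Proof.
have com Y T : g (nabla X Y) T = - g (nabla X T) Y.
  by apply/eqP; rewrite -addr_eq0 [g (nabla X T) _]gC h_nabla.2.
have skew Y : g (nabla X Y) Y = 0 by have := com Y Y; lra.
have JK : J (J Z) = Z.
  by apply: frame_ext; rewrite !product_structure_metric ?opprK.
(* Expanding [Y] leaves only the numbers [g (nabla X ei) ej]; by skewness three of them remain, and
   those involving [e3] cancel in [nabla0]. *)
have nablaE Y T : g (nabla X Y) T = g Y e1 * g (nabla X e1) T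
    + g Y e2 * g (nabla X e2) T - g Y e3 * g (nabla X e3) T.
  rewrite {1}(frame_expand Y) linearBr linearDr !linearZr_LR /=.
  by rewrite !biscalarE.
rewrite /nabla0 /nablaJ JK.
apply: frame_ext; rewrite !biscalarE /= !frame_metric !product_structure_metric;
  rewrite (nablaE Z) (nablaE (J Z)) !product_structure_metric !skew;
  rewrite ?(com e2 e1) ?(com e3 e1) ?(com e3 e2); by field.
Qed.

Lemma curv0E X Y Z : curv0 br nabla J X Y Z =
  w (br X Y) *: (g Z e2 *: e1 - g Z e1 *: e2).
Proof.
rewrite /curv0 !nabla0E.
by apply: frame_ext; rewrite !biscalarE /= !frame_metric; ring.
Qed.

(** The [e3] term of the trace vanishes, since the curvature takes values in the plane of [e1] and
    [e2]. *)
Lemma ric0E X Y : ric0 br g nabla J e1 e2 e3 X Y =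
  w (br X e2) * g Y e1 - w (br X e1) * g Y e2.
Proof. by rewrite /ric0 !curv0E !biscalarE /= !frame_metric; ring. Qed.

End LeviCivita.

(** * Ricci operator and soliton equations for the given bracket *)

Section G6.
Variables (alpha beta gamma delta : R) (br nabla : {bilinear V -> V -> V}).
Hypothesis br_alt : forall X, br X X = 0.
Hypothesis h_12 : br e1 e2 = alpha *: e2 + beta *: e3.
Hypothesis h_13 : br e1 e3 = gamma *: e2 + delta *: e3.
Hypothesis h_23 : br e2 e3 = 0.
Hypothesis h_nabla : levi_civita br g nabla.

Let brC X Y : br X Y = - br Y X.
Proof.
have := br_alt (X + Y); rewrite linearDl !linearDr /= !br_alt add0r addr0.
by move/eqP; rewrite addr_eq0 => /eqP.
Qed.

Lemma g6_brE X Y : br X Y =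
  (g X e1 * g Y e2 - g X e2 * g Y e1) *: (alpha *: e2 + beta *: e3)
  - (g X e1 * g Y e3 - g X e3 * g Y e1) *: (gamma *: e2 + delta *: e3).
Proof.
rewrite {1}(frame_expand X) {1}(frame_expand Y).
rewrite !(linearDl, linearNl, linearZl_LR) /=.
rewrite !(linearDr, linearNr, linearZr_LR) /=.
rewrite (brC e2 e1) (brC e3 e1) (brC e3 e2) !br_alt h_12 h_13 h_23.
by apply: frame_ext; rewrite !biscalarE /= !frame_metric; ring.
Qed.

Lemma g6_connection_form X : g (nabla X e1) e2 =
  - alpha * g X e2 - (beta - gamma) / 2 * g X e3.
Proof.
have K := koszul h_nabla; apply: (@mulfI _ 2); first by rewrite pnatr_eq0.
rewrite K !g6_brE !biscalarE /= !frame_metric ![g _ X]gC; by field.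
Qed.

(** The symmetrized Ricci tensor takes this value on [(e1, e1)] and on [(e2, e2)], and the value
    [g6_ric_mixed] on [(e2, e3)]. *)
Definition g6_ric_plane := beta * (beta - gamma) / 2 - alpha ^+ 2.
Definition g6_ric_mixed := (delta * (beta - gamma) / 2 - alpha * gamma) / 2.
Local Notation p := g6_ric_plane.
Local Notation s := g6_ric_mixed.

Lemma g6_ric0_symE X Y : ric0_sym br g nabla J e1 e2 e3 X Y =
  p * (g X e1 * g Y e1 + g X e2 * g Y e2)
  - s * (g X e3 * g Y e2 + g X e2 * g Y e3).
Proof.
rewrite /ric0_sym !(ric0E h_nabla) !g6_connection_form !g6_brE.
rewrite !biscalarE /= !frame_metric /p /s; by field.
Qed.

Lemma g6_is_Ric0_symP Ric : is_Ric0_sym br g nabla J e1 e2 e3 Ric <->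
  forall X, Ric X = (p * g X e1) *: e1 + (p * g X e2 - s * g X e3) *: e2
                    - (s * g X e2) *: e3.
Proof.
split=> [RicE X | RicE X Y]; last first.
  by rewrite g6_ric0_symE RicE !biscalarE /= ![g _ Y]gC; ring.
apply: frame_ext; rewrite -RicE g6_ric0_symE !biscalarE /= !frame_metric;
  by ring.
Qed.

(** The Ricci operator is unique, so [D] can only be [Ric - c Id]; what remains to be decided is
    whether this map is a derivation. *)
Lemma g6_soliton_derivationP c D :
  soliton_derivation br g nabla J e1 e2 e3 c D <->
  derivation br D /\ forall X, D X =
    ((p - c) * g X e1) *: e1 + ((p - c) * g X e2 - s * g X e3) *: e2
    + (c * g X e3 - s * g X e2) *: e3.
Proof.
split=> [[derD [Ric [/g6_is_Ric0_symP RicE RicD]]] | [derD DE]]; split=> //.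
  move=> X; have -> : D = Ric - c *: \1%VF by rewrite RicD addrC addKr.
  rewrite add_lfunE opp_lfunE scale_lfunE id_lfunE RicE.
  by apply: frame_ext; rewrite !biscalarE /= !frame_metric; ring.
exists (c *: \1%VF + D); split=> //; apply/g6_is_Ric0_symP => X.
rewrite add_lfunE scale_lfunE id_lfunE DE.
by apply: frame_ext; rewrite !biscalarE /= !frame_metric; ring.
Qed.

(** These are the [e2] and [e3] components of the derivation identity on [(e1, e2)] and
    [(e1, e3)]. *)
Lemma g6_soliton_equations c D :
  soliton_derivation br g nabla J e1 e2 e3 c D ->
  [/\ alpha * (p - c) = s * (beta + gamma),
      2 * beta * (p - c) + beta * c + s * (alpha - delta) = 0,
      c * gamma = s * (alpha - delta)
    & delta * (p - c) = - (s * (beta + gamma))].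
Proof.
move=> /g6_soliton_derivationP[derD DE].
have D1 : D e1 = (p - c) *: e1.
  by rewrite DE !frame_metric !(mulr0, mulr1, subr0, scale0r, addr0).
have D2 : D e2 = (p - c) *: e2 - s *: e3.
  rewrite DE !frame_metric !(mulr0, mulr1, subr0, sub0r, scale0r, add0r).
  by rewrite scaleNr.
have D3 : D e3 = s *: e2 - c *: e3.
  rewrite DE !frame_metric !(mulr0, mulrN1, subr0, sub0r, scale0r, add0r).
  by rewrite opprK scaleNr.
have := derD e1 e3; have := derD e1 e2.
rewrite h_12 h_13 !linearD !linearZ /= D1 D2 D3.
rewrite !(linearDr, linearNr, linearZr_LR, linearZl_LR) /= h_12 h_13 => E12 E13.
have := congr1 (g ^~ e2) E12; have := congr1 (g ^~ e3) E12.
have := congr1 (g ^~ e2) E13; have := congr1 (g ^~ e3) E13.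
rewrite /= !biscalarE /= !frame_metric => {E12 E13} E133 E132 E123 E122.
split; lra.
Qed.

End G6.
End ProductStructure.
End PseudoOrthonormalFrame.

Theorem theorem3p14 (R : realType) (alpha beta gamma delta : R)
  (h_ad : alpha + delta <> 0)
  (h_agbd : alpha * gamma - beta * delta = 0)
  (V : vectType R) (br : {bilinear V -> V -> V}) (h_lie : is_lie_bracket br)
  (e1 e2 e3 : V) (h_basis : basis_of fullv [:: e1; e2; e3])
  (h_12 : br e1 e2 = alpha *: e2 + beta *: e3)
  (h_13 : br e1 e3 = gamma *: e2 + delta *: e3)
  (h_23 : br e2 e3 = 0)
  (g : {biscalar V}) (h_g : pseudo_orthonormal g e1 e2 e3)
  (J : 'End(V)) (h_J : product_structure e1 e2 e3 J)
  (nabla : {bilinear V -> V -> V}) (h_nabla : levi_civita br g nabla)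
  (c : R) :
  let case_i := [/\ beta = 0, gamma = 0, alpha ^+ 2 + c = 0
                  & alpha + delta <> 0] in
  let case_ii := [/\ gamma = 0, delta = 0 & c = 0] /\
                 [/\ alpha <> 0, beta <> 0 & beta ^+ 2 = 2 * alpha ^+ 2] in
  [/\ second_kind_algebraic_ricci_soliton br g nabla J e1 e2 e3 c <->
        case_i \/ case_ii,
      case_i -> forall D : 'End(V),
        soliton_derivation br g nabla J e1 e2 e3 c D ->
        [/\ D e1 = 0, D e2 = 0 & D e3 = - c *: e3]
    & case_ii -> forall D : 'End(V),
        soliton_derivation br g nabla J e1 e2 e3 c D -> D = 0].
Proof.
move=> case_i case_ii.
have alt := h_lie.1.
pose p := g6_ric_plane alpha beta gamma.
pose s := g6_ric_mixed alpha beta gamma delta.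
(* Here [beta * delta] is replaced by [alpha * gamma]. *)
have sE : s = - (gamma * (alpha + delta)) / 4.
  by rewrite /s /g6_ric_mixed; lra.
have solP D :=
  g6_soliton_derivationP h_basis h_g h_J alt h_12 h_13 h_23 h_nabla c D.
have eqs D :=
  @g6_soliton_equations _ _ _ _ _ _ h_basis h_g _ h_J _ _ _ _ _ _
    alt h_12 h_13 h_23 h_nabla c D.
rewrite -/p -/s in solP eqs.
have in_i : case_i -> p = c /\ s = 0.
  move=> [b0 g0 cE _]; rewrite sE /p /g6_ric_plane b0 g0; split; lra.
have in_ii : case_ii -> p = c /\ s = 0.
  move=> [[g0 d0 c0] [_ _ bE]]; rewrite sE /p /g6_ric_plane g0; split; lra.
split.
- split=> [[D /eqs[E1 E2 E3 E4]] | cases].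
    have pc : p - c = 0.
      have : (p - c) * (alpha + delta) = 0 by lra.
      by move/eqP; rewrite mulf_eq0 => /orP[/eqP|/eqP/h_ad].
    (* If [gamma] were nonzero, so would be [s]; then [E1] forces [beta = - gamma], and [h_agbd]
       becomes [gamma * (alpha + delta) = 0], a contradiction. *)
    have g0 : gamma = 0.
      apply/eqP/negPn/negP => gN0.
      have : gamma * (alpha + delta) * (beta + gamma) = 0.
        by move: E1; rewrite pc sE; lra.
      move/eqP; rewrite !mulf_eq0 (negPf gN0) /=.
      move=> /orP[/eqP/h_ad // | /eqP bg].
      have : gamma * (alpha + delta) = 0.
        have bE : beta = - gamma by lra.
        by move: h_agbd; rewrite bE; lra.
      by move/eqP; rewrite mulf_eq0 (negPf gN0) => /eqP/h_ad.
    move: E2 h_agbd pc; rewrite sE /p /g6_ric_plane g0 => E2 bd pc.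
    have [b0 | bN0] := eqVneq beta 0; [left | right].
      by split=> //; move: pc; rewrite b0; lra.
    (* With [p = c] and [s = 0], [E2] reduces to [beta * c = 0]. *)
    have c0 : c = 0.
      apply: (mulfI bN0); rewrite mulr0; nra.
    have d0 : delta = 0 by apply: (mulfI bN0); lra.
    split; first by [].
    split; [| exact/eqP | by move: pc; rewrite c0; lra].
    by move=> a0; apply: h_ad; rewrite a0 d0 addr0.
  have [pc s0] : p = c /\ s = 0 by case: cases => [/in_i|/in_ii].
  (* [J - 1] kills [e1] and [e2] and doubles [- e3], so this map sends [e3] to [- c e3]; it is zero
     in case (ii), where [c = 0]. *)
  exists ((c / 2) *: (J - \1%VF)); apply/solP.
  have JE X : ((c / 2) *: (J - \1%VF)) X = (c * g X e3) *: e3.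
    rewrite scale_lfunE add_lfunE opp_lfunE id_lfunE.
    rewrite (product_structureE h_basis h_g h_J).
    apply: (frame_ext h_basis h_g); rewrite !biscalarE /= !(frame_metric h_g);
      by field.
  split=> [X Y | X]; last first.
    by rewrite JE pc s0 subrr !(mul0r, oppr0, scale0r, add0r, addr0).
  (* In case (i) the derivation property holds because [ad e1] is diagonal in the frame. *)
  rewrite !JE !(g6_brE h_basis h_g alt h_12 h_13 h_23).
  apply: (frame_ext h_basis h_g); rewrite !biscalarE /= !(frame_metric h_g);
    by case: cases => [[-> -> _ _]|[[_ _ ->] _]]; ring.
- move=> i D /solP[_ DE]; have [pc s0] := in_i i.
  have gE := frame_metric h_g.
  rewrite !DE pc s0 !gE subrr.
  rewrite !(mul0r, mulr0, mulr1, mulrN1, oppr0, scale0r, addr0, add0r).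
  by split.
- move=> ii D /solP[_ DE]; have [pc s0] := in_ii ii.
  have [[_ _ c0] _] := ii.
  apply/lfunP => X; rewrite DE pc s0 c0 zero_lfunE.
  by rewrite !(subrr, mul0r, scale0r, addr0).
Qed.
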